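(* For every $n \in \mathbb{N}$, $$ d^B_n(x) \;=\; \sum \binom{n}{r_0, r_1, \dots, r_k}\, x^{\lfloor (k+1)/2 \rfloor}\, d_{r_0}(x)\, A_{r_1}(x) \cdots A_{r_k}(x), $$ where the sum ranges over all $k \in \mathbb{N}$ and all sequences $(r_0, r_1, \dots, r_k)$ of nonnegative integers with $r_0 + \cdots + r_k = n$, and where the conventions $A_0(x) = 0$ and $d_0(x) = 1$ are used.
   Context: Type A: for a permutation $u$ of $[m]=\{1,\dots,m\}$, $\mathrm{exc}(u) = \#\{i : u(i) > i\}$ and $\mathrm{des}(u) = \#\{i \in [m-1] : u(i) > u(i+1)\}$. For $m \ge 1$, $A_m(x) = \sum_{u \in \mathfrak{S}_m} x^{\mathrm{des}(u)}$ is the Eulerian polynomial and $d_m(x) = \sum_{u} x^{\mathrm{exc}(u)}$ is the derangement polynomial, where the sum runs over permutations $u \in \mathfrak{S}_m$ without fixed points. Signed permutations: a signed permutation of $[n]$ is a pair consisting of a set $S = \{a_1, \dots, a_n\}$ with $a_i \in \{i, -i\}$ for each $i$, and a bijection $w : S \to S$. The set of all of them is $B_n$. - An element $a \in S$ is a $B$-excedance of $w$ if either $w(a) > a$, or $a < 0$ and $w(a) = a$ (all comparisons are in $\mathbb{Z}$). - $\mathrm{exc}_B(w)$ denotes the number of $B$-excedances of $w$. - $w$ is a derangement if there is no $a \in S$ with $a > 0$ and $w(a) = a$; the set of derangements is $\mathcal{D}^B_n$. - $d^B_n(x) = \sum_{w \in \mathcal{D}^B_n} x^{\mathrm{exc}_B(w)}$,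 with $d^B_0(x) = 1$. *)

(* Defs.v *)
From HB Require Import structures.
From mathcomp Require Import all_boot all_order all_algebra all_fingroup.
Set Implicit Arguments. Unset Strict Implicit. Unset Printing Implicit Defensive.
Import Order.TTheory GRing.Theory Num.Theory.
Local Open Scope ring_scope.

(* Permutations of [m] are encoded as permutations of 'I_m = {0,..,m-1}
   (i <-> i+1); comparisons are unaffected by this shift. *)

Definition excA (m : nat) (u : 'S_m) : nat := #|[set i : 'I_m | (i < u i)%N]|.

Definition desA (m : nat) (u : 'S_m) : nat :=
  #|[set ij : 'I_m * 'I_m | (ij.2 == ij.1.+1 :> nat) && (u ij.2 < u ij.1)%N]|.

Definition eulerianA (m : nat) : {poly int} :=
  if m is 0 then 0 else \sum_(u : 'S_m) 'X^(desA u).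

(* Derangement polynomial d_m(x) (for m = 0 the empty permutation is the
   unique derangement, so d_0 = 1 as required). *)
Definition derangA (m : nat) : {poly int} :=
  \sum_(u : 'S_m | [forall i, u i != i]) 'X^(excA u).

(* A signed permutation of [n] is encoded as a pair (s, sigma):
   s i = true  iff  a_{i+1} = -(i+1)  (so S = {a_1,...,a_n}), and
   w(a_{i+1}) = a_{sigma(i)+1}; this is a bijection with B_n. *)
Definition signedPerm (n : nat) := ({ffun 'I_n -> bool} * {perm 'I_n})%type.

Definition aval (n : nat) (s : {ffun 'I_n -> bool}) (i : 'I_n) : int :=
  if s i then - (i.+1)%:Z else (i.+1)%:Z.

Definition wval (n : nat) (w : signedPerm n) (i : 'I_n) : int :=
  aval w.1 (w.2 i).

Definition isBexc (n : nat) (w : signedPerm n) (i : 'I_n) : bool :=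
  (aval w.1 i < wval w i) || ((aval w.1 i < 0) && (wval w i == aval w.1 i)).

Definition excB (n : nat) (w : signedPerm n) : nat := #|[set i | isBexc w i]|.

Definition derangementB (n : nat) (w : signedPerm n) : bool :=
  ~~ [exists i, (0 < aval w.1 i) && (wval w i == aval w.1 i)].

Definition dB (n : nat) : {poly int} :=
  \sum_(w : signedPerm n | derangementB w) 'X^(excB w).

Definition multinom (k : nat) (r : 'I_k -> nat) : nat :=
  ((\sum_(i < k) r i)`! %/ \prod_(i < k) (r i)`!)%N.

(* Main.v *)
Require Import Defs.
From HB Require Import structures.
From mathcomp Require Import all_boot all_order all_algebra all_fingroup.
From mathcomp Require Import zify ring.
Import Order.TTheory GRing.Theory Num.Theory.
Local Open Scope ring_scope.
Set Implicit Arguments.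
Unset Strict Implicit.

(* Write d(t), A(t), B(t) for the exponential generating functions of d_n, A_n
   and d^B_n, put E = e^t, F = e^(xt) and D = F - x E.
   - Grouping permutations by fixed points, F d and E d count all permutations
     by weak excedances and by excedances; a rotation of the values shows that
     for n > 0 the first is x times the second, so D d = 1 - x.
   - Inserting the largest letter into words (for descents) or into cycles (for
     excedances) yields the same recurrence, so A = E d - 1, hence
     D A = E - F.
   - Once the signs are fixed, a signed permutation is an ordinary permutation
     for another total order; negative fixed points contribute x and
     moved points have two signs, so B(t) = F(t) d(2t).
   - The right-hand side is d (1 + x A) / (1 - x A^2). By the above,
     D^2 (1 - x A^2) = (1 - x) (F^2 - x E^2) and
     D (1 + x A) = (1 - x) F, so it equals (1 - x) F / (F^2 - x E^2) = B.
   Series are truncated to polynomials in t over rat[x], compared modulo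
   t^(n+1). *)

(** * Permutations with prescribed moved points *)

Section ExtendPerm.
Variables (J I : finType) (f : J -> I) (f_inj : injective f).

Definition extend_fun (v : {perm J}) (i : I) : I :=
  if [pick j | f j == i] is Some j then f (v j) else i.

Lemma extend_fun_in v j : extend_fun v (f j) = f (v j).
Proof.
rewrite /extend_fun; case: pickP => [k /eqP/f_inj -> //|/(_ j)].
by rewrite eqxx.
Qed.

Lemma extend_fun_out v i : i \notin codom f -> extend_fun v i = i.
Proof.
rewrite /extend_fun; case: pickP => [k /eqP <-|//].
by rewrite codom_f.
Qed.

Lemma extend_fun_inj v : injective (extend_fun v).
Proof.
move=> i i'.
have [/codomP[j ->]|Hi] := boolP (i \in codom f);
  have [/codomP[j' ->]|Hi'] := boolP (i' \in codom f).
- by rewrite !extend_fun_in => /f_inj/perm_inj ->.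
- by rewrite extend_fun_in extend_fun_out // => E; rewrite -E codom_f in Hi'.
- by rewrite extend_fun_in extend_fun_out // => E; rewrite E codom_f in Hi.
by rewrite !extend_fun_out.
Qed.

Definition extend_perm v : {perm I} := perm (@extend_fun_inj v).

Lemma extend_perm_in v j : extend_perm v (f j) = f (v j).
Proof. by rewrite permE extend_fun_in. Qed.

Lemma extend_perm_out v i : i \notin codom f -> extend_perm v i = i.
Proof. by move=> Hi; rewrite permE extend_fun_out. Qed.

Lemma extend_perm_inj : injective extend_perm.
Proof.
move=> v v' E; apply/permP => j; apply: f_inj.
by rewrite -!extend_perm_in E.
Qed.

(** The inclusion from left to right is direct; equality follows by counting, since both sides have
    [#|J|] factorial elements. *)
Lemma extend_perm_image :
  extend_perm @: [set: {perm J}] = [set u | perm_on [set i in codom f] u].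
Proof.
apply/eqP; rewrite eqEcard; apply/andP; split.
  apply/subsetP => _ /imsetP[v _ ->]; rewrite inE; apply/subsetP => i.
  by rewrite !inE; apply: contraR => /extend_perm_out ->.
rewrite cardsE card_perm cardsE card_codom // (card_imset _ extend_perm_inj).
rewrite cardsT -cardsT -(card_perm [set: J]) -cardsE.
by apply/subset_leq_card/subsetP => u; rewrite !inE.
Qed.

Lemma extend_perm_moved v :
  [set i | extend_perm v i != i] = f @: [set j | v j != j].
Proof.
apply/setP => i; rewrite inE.
have [/codomP[j ->]|Hi] := boolP (i \in codom f).
  by rewrite extend_perm_in (inj_eq f_inj) (mem_imset _ _ f_inj) inE.
rewrite extend_perm_out // eqxx; apply/esym/negP => /imsetP[j _ E].
by rewrite E codom_f in Hi.
Qed.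

End ExtendPerm.

(** Listing [T] by increasing [key] turns excedances measured by [key] on [T] into ordinary
    excedances on ['I_#|T|]. *)
Lemma sorted_enumeration (I : finType) (key : I -> int) (T : {set I}) :
  injective key ->
  exists2 f : 'I_#|T| -> I, [set i in codom f] = T &
    forall j k, (key (f j) < key (f k)) = (j < k)%N.
Proof.
move=> key_inj; pose r := relpre key <=%R.
have r_total : total r by move=> x y; apply: le_total.
have r_trans : transitive r by move=> y x z; apply: le_trans.
have r_refl : reflexive r by move=> x; apply: lexx.
pose s := sort r (enum T).
have sz_s : size s == #|T| by rewrite size_sort cardE.
pose t := Tuple sz_s.
have t_inj : injective (tnth t).
  by apply/tuple_uniqP; rewrite /= sort_uniq enum_uniq.
have mono (j k : 'I_#|T|) : (j <= k)%N -> key (tnth t j) <= key (tnth t k).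
  move=> le_jk; rewrite (tnth_nth (tnth t j) t k).
  rewrite {1}(tnth_nth (tnth t j) t j) /=.
  apply: (sorted_leq_nth r_trans r_refl) => //; rewrite ?inE ?(eqP sz_s) //.
  exact: sort_sorted.
exists (tnth t).
  apply/setP => i; rewrite inE.
  have -> : (i \in T) = (i \in t) by rewrite mem_sort mem_enum.
  by apply/codomP/tnthP.
move=> j k; case: (ltnP j k) => [lt_jk|le_kj]; last first.
  by apply/negbTE; rewrite -leNgt mono.
rewrite lt_neqAle mono ?(ltnW lt_jk) // andbT (inj_eq key_inj) (inj_eq t_inj).
by rewrite neq_ltn lt_jk.
Qed.

(* Excedances are measured through an arbitrary injective [key], so that the
   order of the values of a signed permutation is covered as well. *)
Lemma sum_exc_moved (I : finType) (key : I -> int) (T : {set I}) :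
  injective key ->
  \sum_(u : {perm I} | [set i | u i != i] == T)
    'X^#|[set i | key i < key (u i)]| = derangA #|T| :> {poly int}.
Proof.
move=> key_inj; have [f fT f_mono] := sorted_enumeration T key_inj.
have f_inj : injective f.
  move=> j k E; apply/val_inj/eqP; case: ltngtP => //.
    by rewrite -f_mono E ltxx.
  by rewrite -f_mono E ltxx.
pose der := [set v : 'S_#|T| | [forall j, v j != j]].
(* The permutations with moved set [T] are exactly the extensions along [f] of the derangements in
   [der]. *)
rewrite (eq_bigl (mem (extend_perm f_inj @: der))).
  rewrite big_imset /=; last by move=> v v' _ _; apply: extend_perm_inj.
  rewrite /derangA; apply: eq_big => [v|v _]; first by rewrite inE.
  congr ('X^_); rewrite /excA -(card_imset _ f_inj); apply: eq_card => i.
  rewrite inE; have [/codomP[j ->]|Hi] := boolP (i \in codom f).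
    by rewrite extend_perm_in f_mono (mem_imset _ _ f_inj) inE.
  rewrite extend_perm_out // ltxx; apply/esym/negP => /imsetP[j _ E].
  by rewrite E codom_f in Hi.
have Tf j : f j \in T by rewrite -fT inE codom_f.
move=> u /=; apply/eqP/imsetP => [uT|[v]].
  have : u \in extend_perm f_inj @: [set: {perm 'I_#|T|}].
    rewrite extend_perm_image inE fT -uT; apply/subsetP => i.
    by rewrite !inE.
  case/imsetP => v _ def_u; exists v => //; rewrite inE; apply/forallP => j.
  have /setP/(_ (f j)) := uT.
  by rewrite def_u extend_perm_moved (mem_imset _ _ f_inj) Tf inE => ->.
rewrite inE => /forallP v_der ->; rewrite extend_perm_moved -[RHS]fT.
apply/setP => i; rewrite inE; apply/imsetP/codomP => [[j _ ->]|[j ->]].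
  by exists j.
by exists j => //; rewrite inE.
Qed.

Lemma sum_by_card (V : nmodType) (I : finType) (F : nat -> V) :
  \sum_(T : {set I}) F #|T| = \sum_(k < #|I|.+1) F k *+ 'C(#|I|, k).
Proof.
rewrite (partition_big (fun T : {set I} => inord #|T| : 'I_#|I|.+1) xpredT) //=.
apply: eq_bigr => k _; rewrite -card_draws -sumr_const.
apply: eq_big => [T|T /eqP <-]; last by rewrite inordK // ltnS max_card.
by rewrite inE -val_eqE /= inordK // ltnS max_card.
Qed.

(** * Excedances and weak excedances, grouped by fixed points *)

Definition excPoly n : {poly int} := \sum_(u : 'S_n) 'X^(excA u).

Definition wexcPoly n : {poly int} :=
  \sum_(u : 'S_n) 'X^#|[set i : 'I_n | (i <= u i)%N]|.

(** Binomial convolution: the product of exponential generating functions, read on coefficients. *)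
Definition binconv (R : nzSemiRingType) (a b : nat -> R) n : R :=
  \sum_(k < n.+1) (a k * b (n - k)%N) *+ 'C(n, k).

Lemma ord_key_inj n : injective (fun i : 'I_n => (i : nat)%:Z).
Proof. by move=> i j [] /val_inj. Qed.

(** A fixed point is never an excedance, so each one has weight 1. *)
Lemma excPolyE n : excPoly n = binconv derangA (fun=> 1) n.
Proof.
rewrite /binconv; under eq_bigr do rewrite mulr1.
have := @sum_by_card _ 'I_n derangA; rewrite card_ord => <-; rewrite /excPoly.
rewrite (partition_big (fun u : 'S_n => [set i | u i != i]) xpredT) //=.
by apply: eq_bigr => T _; rewrite -(sum_exc_moved T (@ord_key_inj n)).
Qed.

(** A fixed point is always a weak excedance, so each one has weight ['X]. *)
Lemma wexcPolyE n : wexcPoly n = binconv derangA (fun k => 'X^k) n.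
Proof.
rewrite /binconv.
have := @sum_by_card _ 'I_n (fun k => derangA k * 'X^(n - k)).
rewrite card_ord => <-; rewrite /wexcPoly.
rewrite (partition_big (fun u : 'S_n => [set i | u i != i]) xpredT) //=.
apply: eq_bigr => T _; rewrite -(sum_exc_moved T (@ord_key_inj n)) mulr_suml.
apply: eq_bigr => u /eqP <-; rewrite -exprD; congr ('X^_).
have -> : (n - #|[set i | u i != i]|)%N = #|~: [set i | u i != i]|.
  by rewrite [RHS]cardsCs setCK card_ord.
(* Excedances and fixed points are disjoint, and their union is the set of weak excedances. *)
rewrite -cardsUI [X in (_ + X)%N]eq_card0 ?addn0 => [|i]; last first.
  by rewrite !inE negbK; case: eqP => [->|]; rewrite ?ltxx ?andbF.
by apply: eq_card => i; rewrite !inE negbK ltz_nat leq_eqVlt orbC eq_sym.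
Qed.

(* Composing with the cycle [i -> i + 1 mod n + 1] turns every weak excedance
   into an excedance, except the one whose image is maximal. *)
Lemma wexcPolyS n : wexcPoly n.+1 = 'X * excPoly n.+1.
Proof.
rewrite /wexcPoly /excPoly mulr_sumr.
pose c : 'S_n.+1 := perm (@ordS_inj n.+1).
rewrite [RHS](reindex_inj (mulIg c)) /=.
apply: eq_bigr => u _; rewrite -exprS; congr ('X^_).
pose last := (u^-1)%g ord_max.
have u_last : u last = ord_max by rewrite permKV.
have ordS_lt (j : 'I_n.+1) : j != ord_max -> (j.+1 %% n.+1 = j.+1)%N.
  rewrite -val_eqE /= => j_max; rewrite modn_small // ltnS ltn_neqAle j_max.
  exact: leq_ord.
rewrite (cardsD1 last) inE u_last leq_ord add1n; congr _.+1.
apply: eq_card => i; rewrite !inE permM permE.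
have [->|i_last] /= := eqVneq i last.
  by rewrite u_last /= modnn ltn0.
rewrite ordS_lt ?ltnS //.
by apply: contraNneq i_last => u_i; rewrite /last -u_i permK.
Qed.

(** * Signed derangements *)

Lemma absz_aval n (s : {ffun 'I_n -> bool}) i : `|aval s i|%N = i.+1.
Proof. by rewrite /aval; case: (s i); rewrite ?abszN. Qed.

Lemma aval_inj n (s : {ffun 'I_n -> bool}) : injective (aval s).
Proof.
move=> i j E; apply: val_inj; apply: succn_inj.
by rewrite -!(absz_aval s) E.
Qed.

Lemma aval_lt0 n (s : {ffun 'I_n -> bool}) i : (aval s i < 0) = s i.
Proof. by rewrite /aval; case: (s i). Qed.

Lemma aval_gt0 n (s : {ffun 'I_n -> bool}) i : (0 < aval s i) = ~~ s i.
Proof. by rewrite /aval; case: (s i). Qed.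

(** The indicator of the condition is a product over [i]; distributing the sum gives a factor 2 for
    [i] in [T] and 1 otherwise. *)
Lemma card_signs (I : finType) (T : {set I}) :
  #|[set s : {ffun I -> bool} | [forall i, (i \in T) || s i]]| = (2 ^ #|T|)%N.
Proof.
rewrite -sum1dep_card big_mkcond /=.
rewrite (eq_bigr (fun s : {ffun I -> bool} =>
  \prod_i (((i \in T) || s i) : nat))%N) => [|s _].
  rewrite -(bigA_distr_bigA (fun i (b : bool) => ((i \in T) || b) : nat)) /=.
  rewrite -prod_nat_const [RHS]big_mkcond; apply: eq_bigr => i _.
  by rewrite big_bool /=; case: (i \in T).
case: forallP => [s1|/forallP]; first by rewrite big1 // => i _; rewrite s1.
by rewrite negb_forall => /existsP[i /negbTE s0]; rewrite (bigD1 i) //= s0.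
Qed.

(** A fixed point of a derangement is negative, hence a [B]-excedance; the other [B]-excedances are
    strict rises for the order given by [aval s]. *)
Lemma excB_split n (s : {ffun 'I_n -> bool}) (u : 'S_n) :
  derangementB (s, u) ->
  excB (s, u) = (#|[set i | (aval s i < aval s (u i))%R]|
                 + (n - #|[set i | u i != i]|))%N.
Proof.
rewrite /derangementB negb_exists => /forallP der.
have -> : (n - #|[set i | u i != i]|)%N = #|~: [set i | u i != i]|.
  by rewrite [RHS]cardsCs setCK card_ord.
rewrite -cardsUI [X in (_ + X)%N]eq_card0 ?addn0 => [|i]; last first.
  by rewrite !inE negbK; case: eqP => [->|]; rewrite ?ltxx ?andbF.
apply: eq_card => i; rewrite !inE negbK /isBexc /wval /= aval_lt0.
rewrite (inj_eq (@aval_inj n s)); congr (_ || _).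
have := der i; rewrite /wval /= aval_gt0 (inj_eq (@aval_inj n s)).
by case: (s i); case: (u i == i).
Qed.

Lemma derangementB_moved n (s : {ffun 'I_n -> bool}) (u : 'S_n) :
  derangementB (s, u) = [forall i, (i \in [set i | u i != i]) || s i].
Proof.
rewrite /derangementB negb_exists; apply: eq_forallb => i.
rewrite inE /wval /= aval_gt0 (inj_eq (@aval_inj n s)).
by case: (s i); case: (u i == i).
Qed.

(** With moved set [T], signs are free on [T] and forced negative elsewhere. For each choice,
    [sum_exc_moved] with key [aval s] gives [derangA], and each fixed point contributes ['X]. *)
Lemma dBE n :
  dB n = binconv (fun k => derangA k *+ 2 ^ k) (fun k => 'X^k) n.
Proof.
rewrite /binconv.
have := @sum_by_card _ 'I_n (fun k => (derangA k *+ 2 ^ k) * 'X^(n - k)).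
rewrite card_ord => <-.
transitivity (\sum_(s : {ffun 'I_n -> bool})
    \sum_(u : 'S_n | derangementB (s, u)) 'X^(excB (s, u)) : {poly int}).
  by rewrite pair_big_dep /=; apply: eq_big => [[]|[]].
under eq_bigr => s _ do
  rewrite (partition_big (fun u : 'S_n => [set i | u i != i]) xpredT) //=.
rewrite exchange_big /=; apply: eq_bigr => T _.
rewrite -card_signs mulrnAl -sumr_const [RHS]big_mkcond /=.
apply: eq_bigr => s _; rewrite inE; case: ifPn => [sT|sT]; last first.
  apply: big_pred0 => u; apply/negP => /andP[].
  by rewrite derangementB_moved => + /eqP uT; rewrite uT; apply/negP.
rewrite -(sum_exc_moved T (@aval_inj n s)) mulr_suml.
apply: eq_big => [u|u /andP[der /eqP <-]].
  by case: eqP => [uT|]; rewrite ?andbF // derangementB_moved uT sT.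
by rewrite excB_split // exprD.
Qed.

(** * Equidistribution of descents and excedances *)

(** Both index sets have [(n+1)!] elements, so injectivity of the insertion suffices. *)
Lemma insertion_bij n (ins : 'I_n.+1 -> 'S_n -> 'S_n.+1) :
  (forall i j u v, ins i u = ins j v -> i = j /\ u = v) ->
  forall F : 'S_n.+1 -> {poly int},
  \sum_u F u = \sum_(u : 'S_n) \sum_(i < n.+1) F (ins i u).
Proof.
move=> ins_inj F; rewrite exchange_big pair_big /=.
rewrite (reindex (fun p : 'I_n.+1 * 'S_n => ins p.1 p.2)) //=.
apply/onW_bij/inj_card_bij.
  by case=> [i u] [j v] /= /ins_inj[-> ->].
by rewrite card_prod !card_Sn card_ord factS.
Qed.

(** [P] marks the [d + 1] insertion places that preserve a statistic of value [d]; each of the other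
    [n - d] raises it by one. *)
Lemma insert_max_sum n (P : pred 'I_n.+1) d :
  #|P| = d.+1 ->
  \sum_(i < n.+1) ('X^(d + ~~ P i)%N : {poly int})
    = 'X^d *+ d.+1 + 'X^(d.+1) *+ (n - d)%N.
Proof.
move=> Pd; rewrite (bigID P) /=; congr (_ + _).
  rewrite -Pd -sumr_const; apply: eq_bigr => i ->.
  by rewrite addn0.
have -> : (n - d)%N = #|[predC P]|.
  suff: (d.+1 + #|[predC P]| = n.+1)%N by lia.
  by rewrite -Pd cardC card_ord.
rewrite -sumr_const; by apply: eq_bigr => i ->; rewrite addn1.
Qed.

(** * Excedances: insertion of the maximum into cycles *)

Lemma excA_sum n (u : 'S_n) : excA u = (\sum_(i < n) (i < u i))%N.
Proof. by rewrite /excA cardsE -sum1_card big_mkcond. Qed.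

(** For [i] other than [ord_max], the new maximum comes right after [i] in its cycle; for
    [i = ord_max] it is a fixed point. *)
Definition exc_insert n (i : 'I_n.+1) (u : 'S_n) : 'S_n.+1 :=
  (tperm i ord_max * lift_perm ord_max ord_max u)%g.

Lemma exc_insert_inj n (i j : 'I_n.+1) u v :
  exc_insert i u = exc_insert j v -> i = j /\ u = v.
Proof.
move=> E; have ij : i = j.
  have := congr1 (fun w : 'S_n.+1 => (w^-1)%g ord_max) E.
  rewrite /exc_insert !invMg !permM !tpermV !lift_permV.
  by rewrite !lift_perm_id !tpermR.
split=> //; move: E; rewrite /exc_insert ij => /mulgI E.
apply/permP => k; apply: (@lift_inj _ ord_max).
by rewrite -!(lift_perm_lift ord_max) E.
Qed.

Lemma widen_ord_lift n (k : 'I_n) : widen_ord (leqnSn n) k = lift ord_max k.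
Proof.
by apply: val_inj; rewrite -[RHS]/(nat_of_ord (lift ord_max k)) lift_max.
Qed.

(** Insertion after [k] makes [k] an excedance and sends the maximum downwards, so the count grows
    unless [k] was an excedance already. A new fixed point changes nothing. *)
Lemma excA_insert n (i : 'I_n.+1) (u : 'S_n) :
  excA (exc_insert i u) =
  (excA u + ~~ (if unlift ord_max i is Some k then (k < u k)%N else true))%N.
Proof.
rewrite excA_sum big_ord_recr /= ltnNge leq_ord addn0.
under eq_bigr => k _ do rewrite widen_ord_lift.
rewrite excA_sum; case: unliftP => [k0 ->|->]; last first.
  rewrite addn0; apply: eq_bigr => k _.
  by rewrite /exc_insert tperm1 mul1g lift_perm_lift lift_max.
rewrite (bigD1 k0) //= [in RHS](bigD1 k0) //=.
rewrite [in LHS](eq_bigr (fun k : 'I_n => (k < u k)%N : nat)) => [|k ne_k].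
  rewrite permM tpermL lift_perm_id /= ltn_ord; lia.
rewrite permM tpermD ?lift_perm_lift ?lift_max //.
by rewrite (inj_eq lift_inj) eq_sym.
exact: neq_lift.
Qed.

Lemma excPolyS n : excPoly n.+1 =
  \sum_(u : 'S_n)
    ('X^(excA u) *+ (excA u).+1 + 'X^((excA u).+1) *+ (n - excA u)).
Proof.
rewrite /excPoly (insertion_bij (@exc_insert_inj n)).
apply: eq_bigr => u _; under eq_bigr do rewrite excA_insert.
apply: insert_max_sum; rewrite -sum1_card big_mkcond big_ord_recr /=.
rewrite unfold_in unlift_none addn1 excA_sum; congr _.+1.
by apply: eq_bigr => k _; rewrite widen_ord_lift unfold_in liftK.
Qed.

(** * Descents: insertion of the maximum into words *)

Definition des_seq (w : nat -> nat) m : nat := \sum_(k < m) (w k.+1 < w k)%N.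

(** Words are functions on [nat], so that descents can be counted by induction on a prefix. *)
Definition word n (u : 'S_n) (k : nat) : nat :=
  if insub k is Some i then u i else 0%N.

Lemma wordE n (u : 'S_n) (i : 'I_n) : word u i = u i.
Proof. by rewrite /word valK. Qed.

Lemma desA_seq n (u : 'S_n) : desA u = des_seq (word u) n.-1.
Proof.
case: n u => [|n] u.
  by rewrite /des_seq big_ord0; apply/eq_card0 => -[[]].
pose g (k : 'I_n) := (widen_ord (leqnSn n) k, lift ord0 k).
have g_inj : injective g by move=> k k' [] /val_inj.
rewrite /des_seq /desA -big_mkcond sum1dep_card -(card_imset _ g_inj).
apply: eq_card => -[i j]; rewrite inE /=; apply/andP/imsetP.
  case=> /eqP ij lt_u; have lt_in : (i < n)%N by rewrite -ltnS -ij.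
  have def_ij : (i, j) = g (Ordinal lt_in).
    by congr (_, _); apply: val_inj; rewrite //= /bump.
  exists (Ordinal lt_in) => //.
  by rewrite inE /= -ij !wordE.
case=> k; rewrite inE => lt_w [-> ->]; split=> //.
by rewrite -!wordE.
Qed.

Lemma des_seqS w m : des_seq w m.+1 = (des_seq w m + (w m.+1 < w m))%N.
Proof. exact: big_ord_recr. Qed.

Lemma eq_des_seq w w' m : (forall k, (k <= m)%N -> w k = w' k) ->
  des_seq w m = des_seq w' m.
Proof.
by move=> E; apply: eq_bigr => k _; rewrite !E // ltnW.
Qed.

Definition insert_val (i M : nat) (w : nat -> nat) (k : nat) : nat :=
  if (k < i)%N then w k else if k == i then M else w k.-1.

(** The letter [M] creates a descent unless it comes last, and destroys the old descent, if any, at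
    the gap it fills. The additive form avoids truncated subtraction. *)
Lemma des_seq_insert n i M w :
  (i <= n)%N -> (forall k, (k < n)%N -> (w k < M)%N) ->
  (des_seq (insert_val i M w) n + [&& 0 < i, i < n & w i < w i.-1]
   = des_seq w n.-1 + (i < n))%N.
Proof.
elim: n => [|n IH] le_in w_lt.
  by rewrite /des_seq !big_ord0 !ltn0 andbF.
have IH' := fun H => IH H (fun k lt_kn => w_lt k (ltnW lt_kn)).
(* The last pair of letters depends on whether [M] comes last, next to last or earlier. *)
rewrite des_seqS /=; have [->|ne_i] := eqVneq i n.+1.
  rewrite ltnn andbF addn0 addn0 /insert_val ltnn eqxx ltnSn.
  rewrite [(M < _)%N]ltnNge ltnW ?w_lt // addn0.
  by apply: eq_des_seq => k le_kn; rewrite ltnS le_kn.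
have le_in' : (i <= n)%N by rewrite -ltnS ltn_neqAle ne_i.
have -> : insert_val i M w n.+1 = w n.
  by rewrite /insert_val ltnNge leqW //= gtn_eqF.
have -> : insert_val i M w n = if n == i then M else w n.-1.
  by rewrite /insert_val ltnNge le_in'.
have := IH' le_in'; rewrite ltnS le_in' /=.
have [->|ne_in] := eqVneq n i.
  rewrite ltnn andbF w_lt //; case: (i) => [|j] /=.
    by rewrite !addn0 => ->.
  by rewrite (des_seqS w); lia.
have lt_in : (i < n)%N by rewrite ltn_neqAle eq_sym ne_in.
case: (n) lt_in => // m lt_im.
by rewrite lt_im /= (des_seqS w); lia.
Qed.

Definition des_insert n (i : 'I_n.+1) (u : 'S_n) : 'S_n.+1 :=
  lift_perm i ord_max u.

Lemma des_insert_inj n (i j : 'I_n.+1) u v :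
  des_insert i u = des_insert j v -> i = j /\ u = v.
Proof.
rewrite /des_insert => E; have ij : i = j.
  have := congr1 (fun w : 'S_n.+1 => (w^-1)%g ord_max) E.
  by rewrite !lift_permV !lift_perm_id.
split=> //; apply/permP => k; apply: (@lift_inj _ ord_max).
by rewrite -!(lift_perm_lift i) E ij.
Qed.

Lemma word_insert n (i : 'I_n.+1) (u : 'S_n) k : (k <= n)%N ->
  word (des_insert i u) k = insert_val i n (word u) k.
Proof.
move=> le_kn; rewrite /insert_val -[k]/(val (Ordinal (le_kn : (k < n.+1)%N))).
move: (Ordinal _) => {le_kn} k'; rewrite wordE /des_insert.
case: (unliftP i k') => [j ->|->]; last by rewrite lift_perm_id ltnn eqxx.
rewrite lift_perm_lift lift_max -wordE /= /bump.
case: (leqP i j) => [le_ij|lt_ji]; last by rewrite add0n lt_ji.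
by rewrite add1n ltnNge leqW //= gtn_eqF.
Qed.

(** The places that keep the number of descents are the end of the word and the gaps inside a
    descent: [desA u + 1] in all, as for excedances. *)
Lemma desA_insert n (i : 'I_n.+1) (u : 'S_n) :
  desA (des_insert i u) = (desA u +
    ~~ ((i == n :> nat) || [&& 0 < i, i < n & word u i < word u i.-1]))%N.
Proof.
rewrite !desA_seq /= (eq_des_seq (word_insert i u)).
have w_lt k : (k < n)%N -> (word u k < n)%N.
  by move=> lt_kn; rewrite -[k]/(val (Ordinal lt_kn)) wordE.
have := des_seq_insert (leq_ord i) w_lt.
case: ltngtP (leq_ord i) => //=; lia.
Qed.

Definition desPoly n : {poly int} := \sum_(u : 'S_n) 'X^(desA u).

Lemma desPolyS n : desPoly n.+1 =
  \sum_(u : 'S_n)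
    ('X^(desA u) *+ (desA u).+1 + 'X^((desA u).+1) *+ (n - desA u)).
Proof.
rewrite /desPoly (insertion_bij (@des_insert_inj n)).
apply: eq_bigr => u _; under eq_bigr do rewrite desA_insert.
apply: (@insert_max_sum n (fun i : 'I_n.+1 =>
  (i == n :> nat) || [&& 0 < i, i < n & word u i < word u i.-1])%N).
rewrite -sum1_card big_mkcond big_ord_recr /= unfold_in eqxx addn1 desA_seq.
congr _.+1; rewrite (eq_bigr (fun k : 'I_n =>
  [&& 0 < k & word u k < word u k.-1]%N : nat)).
  case: n u => [|n] u; first by rewrite /des_seq !big_ord0.
  by rewrite big_ord_recl.
by move=> k _; rewrite unfold_in /= ltn_ord ltn_eqF //=; case: ifP.
Qed.

Lemma desA_le n (u : 'S_n) : (desA u <= n)%N.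
Proof.
rewrite desA_seq; apply: leq_trans (leq_pred n).
by rewrite -[leqRHS]card_ord -sum1_card; apply: leq_sum => k _; case: (_ < _)%N.
Qed.

(** The operator of the classical Eulerian recurrence; it is linear, so monomials suffice to
    identify it. *)
Definition eulerian_step n (p : {poly int}) : {poly int} :=
  (1 + 'X *+ n) * p + 'X * (1 - 'X) * p^`().

Lemma eulerian_stepXn n k : (k <= n)%N ->
  'X^k *+ k.+1 + 'X^(k.+1) *+ (n - k) = eulerian_step n 'X^k.
Proof.
rewrite /eulerian_step derivXn => /subnK; move: (n - k)%N => m <- {n}.
by case: k => [|k]; rewrite ?expr0 ?exprS; ring.
Qed.

Lemma eulerian_step_sum (I : finType) n (st : I -> nat) :
  (forall u, (st u <= n)%N) ->
  \sum_u ('X^(st u) *+ (st u).+1 + 'X^((st u).+1) *+ (n - st u)) =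
  eulerian_step n (\sum_u 'X^(st u)).
Proof.
move=> st_le; rewrite /eulerian_step raddf_sum !mulr_sumr -big_split /=.
by apply: eq_bigr => u _; exact: eulerian_stepXn.
Qed.

Lemma desPoly_excPoly n : desPoly n = excPoly n.
Proof.
elim: n => [|n IH].
  by apply: eq_bigr => u _; rewrite desA_seq excA_sum /des_seq !big_ord0.
rewrite desPolyS excPolyS !eulerian_step_sum.
- by congr eulerian_step; exact: IH.
- by move=> u; rewrite -[leqRHS]card_ord max_card.
- exact: desA_le.
Qed.

(** * Truncated exponential generating functions *)

Definition eqmodX (R : nzRingType) N (p q : {poly R}) :=
  forall i, (i < N)%N -> p`_i = q`_i.

Lemma eqmodX_sym (R : nzRingType) N (p q : {poly R}) :
  eqmodX N p q -> eqmodX N q p.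
Proof. by move=> E i /E. Qed.

Lemma eqmodX_trans (R : nzRingType) N (q p r : {poly R}) :
  eqmodX N p q -> eqmodX N q r -> eqmodX N p r.
Proof. by move=> E1 E2 i lt_iN; rewrite E1 ?E2. Qed.

Lemma eqmodXB (R : nzRingType) N (p p' q q' : {poly R}) :
  eqmodX N p p' -> eqmodX N q q' -> eqmodX N (p - q) (p' - q').
Proof. by move=> E1 E2 i lt_iN; rewrite !coefB E1 ?E2. Qed.

Lemma eqmodXD (R : nzRingType) N (p p' q q' : {poly R}) :
  eqmodX N p p' -> eqmodX N q q' -> eqmodX N (p + q) (p' + q').
Proof. by move=> E1 E2 i lt_iN; rewrite !coefD E1 ?E2. Qed.

Lemma eqmodXM (R : nzRingType) N (p p' q q' : {poly R}) :
  eqmodX N p p' -> eqmodX N q q' -> eqmodX N (p * q) (p' * q').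
Proof.
move=> E1 E2 i lt_iN; rewrite !coefM; apply: eq_bigr => j _.
rewrite E1 ?E2 //; first exact: leq_ltn_trans (leq_subr _ _) lt_iN.
by apply: leq_trans lt_iN; exact: ltn_ord.
Qed.

Lemma eqmodXMl (R : nzRingType) N (r p q : {poly R}) :
  eqmodX N p q -> eqmodX N (r * p) (r * q).
Proof. exact: eqmodXM. Qed.

(** Once the lower coefficients of [p - q] vanish, coefficient [i] of [m * (p - q)] is that of
    [p - q] times the constant term of [m]. *)
Lemma eqmodX_cancel (R : idomainType) N (m p q : {poly R}) :
  m`_0 != 0 -> eqmodX N (m * p) (m * q) -> eqmodX N p q.
Proof.
move=> m0 E; suff E0 i : (i < N)%N -> (p - q)`_i = 0.
  by move=> i /E0/eqP; rewrite coefB subr_eq0 => /eqP.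
elim/ltn_ind: i => i IH lt_iN; have := E i lt_iN; move/eqP.
rewrite -subr_eq0 -coefB -mulrBr coefM big_ord_recl subn0 big1 ?addr0.
  by rewrite mulf_eq0 (negbTE m0) => /eqP.
move=> j _ /=; rewrite /bump add1n IH ?mulr0 //; last first.
  by apply: leq_ltn_trans lt_iN; exact: leq_subr.
by have := ltn_ord j; lia.
Qed.

Lemma eqmodX_exp0 (R : idomainType) N k (p : {poly R}) :
  p`_0 = 0 -> (N <= k)%N -> eqmodX N (p ^+ k) 0.
Proof.
elim: k N => [|k IH] [|N] // p0 le_Nk i lt_i.
rewrite exprS coefM coef0; apply: big1 => [[[|j] lt_j]] _ /=.
  by rewrite p0 mul0r.
by rewrite (IH N) ?coef0 ?mulr0 //; lia.
Qed.

(** Rational coefficients allow division by factorials; [toQ_inj] brings the identity back to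
    integers. *)
Definition toQ : {poly int} -> {poly rat} := map_poly intr.

HB.instance Definition _ := GRing.RMorphism.copy toQ (map_poly intr).

Lemma toQX : toQ 'X = 'X. Proof. exact: map_polyX. Qed.

Lemma toQ_inj : injective toQ.
Proof. by apply: map_inj_poly => //; exact: intr_inj. Qed.

(** The outer variable is t and the inner one is x, so ['X%:P] stands for x. *)
Definition egf N (a : nat -> {poly int}) : {poly {poly rat}} :=
  \poly_(i < N.+1) ((i`!%:R : rat)^-1 *: toQ (a i)).

Lemma coef_egf N a i : (i <= N)%N ->
  (egf N a)`_i = (i`!%:R : rat)^-1 *: toQ (a i).
Proof. by move=> le_iN; rewrite coef_poly ltnS le_iN. Qed.

Lemma egfM N a b : eqmodX N.+1 (egf N a * egf N b) (egf N (binconv a b)).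
Proof.
move=> i; rewrite ltnS => le_iN.
rewrite coef_egf // coefM /binconv rmorph_sum scaler_sumr.
apply: eq_bigr => j _; have le_ji : (j <= i)%N by rewrite -ltnS ltn_ord.
rewrite !coef_egf ?(leq_trans le_ji) ?(leq_trans (leq_subr _ _)) //.
rewrite rmorphMn rmorphM /= -scaler_nat -scalerAl -scalerAr !scalerA.
congr (_ *: _); rewrite -(bin_fact le_ji) !natrM.
have nz k : (k`!%:R : rat) != 0 by rewrite pnatr_eq0 -lt0n fact_gt0.
have nzb : ('C(i, j)%:R : rat) != 0 by rewrite pnatr_eq0 -lt0n bin_gt0.
by rewrite [RHS]mulrC invfM mulrA mulfV // mul1r invfM.
Qed.

Lemma egf_eq N a b : (forall i, a i = b i) -> egf N a = egf N b.
Proof. by move=> E; apply/polyP => i; rewrite !coef_poly E. Qed.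

(** Ensures that the division in [multinom] is exact; adding one part brings in a binomial
    coefficient. *)
Lemma dvdn_prod_fact (k : nat) (r : 'I_k -> nat) :
  (\prod_(i < k) (r i)`! %| (\sum_(i < k) r i)`!)%N.
Proof.
elim/big_rec2: _ => // i s p _ dvd_ps.
by rewrite -(bin_fact (leq_addr s (r i))) addKn dvdn_mull // dvdn_mul.
Qed.

(** Distributivity chooses a degree [r i] in each factor, and the inverse factorials assemble into
    [multinom] over [N!]. *)
Lemma coef_prod_egf N k (a : 'I_k -> nat -> {poly int}) :
  (\prod_(i < k) egf N (a i))`_N = (N`!%:R : rat)^-1 *:
    toQ (\sum_(r : {ffun 'I_k -> 'I_N.+1} | (\sum_(i < k) (r i : nat))%N == N)
           (multinom (fun i => r i : nat))%:R *: \prod_(i < k) a i (r i)).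
Proof.
under eq_bigr do rewrite /egf poly_def.
rewrite bigA_distr_bigA /= coef_sum [in RHS]big_mkcond rmorph_sum scaler_sumr.
apply: eq_bigr => r _.
rewrite scaler_prod prodrXr coefZ coefXn eq_sym.
case: eqP => [rN|_]; last by rewrite mulr0 rmorph0 scaler0.
rewrite mulr1 scaler_prod scaler_nat rmorphMn /= rmorph_prod -scaler_nat.
rewrite scalerA; congr (_ *: _).
have nz j : (j`!%:R : rat) != 0 by rewrite pnatr_eq0 -lt0n fact_gt0.
rewrite /multinom rN; apply: (mulfI (nz N)); rewrite mulVKf //.
have := dvdn_prod_fact (fun i => r i : nat); rewrite rN => /divnK def_N.
rewrite -{1}def_N natrM natr_prod prodfV mulfK //.
by apply/prodf_neq0 => i _.
Qed.

(** Raising [k] by two raises the exponent of [x] by one, so the product telescopes: the terms for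
    [k = 0] and [k = 1] remain, together with a tail divisible by [A ^+ K.+1]. *)
Lemma half_geometric_sum (R : idomainType) N K (x : R) (A : {poly R}) :
  A`_0 = 0 -> (N <= K.+1)%N ->
  eqmodX N
    ((1 - x%:P * A ^+ 2) * \sum_(k < K.+1) (x ^+ (k.+1 %/ 2))%:P * A ^+ k)
    (1 + x%:P * A).
Proof.
move=> A0 le_NK.
have -> :
  (1 - x%:P * A ^+ 2) * (\sum_(k < K.+1) (x ^+ (k.+1 %/ 2))%:P * A ^+ k)
  = 1 + x%:P * A -
    ((x ^+ (K.+2 %/ 2))%:P + (x ^+ (K.+3 %/ 2))%:P * A) * A ^+ K.+1.
  elim: K {le_NK} => [|K IH].
    by rewrite big_ord_recr big_ord0 /= !divnS //=; ring.
  rewrite big_ord_recr mulrDr IH /=.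
  have -> : (K.+4 %/ 2 = (K.+2 %/ 2).+1)%N by lia.
  by rewrite !rmorphXn /= !exprS; ring.
rewrite -[X in eqmodX _ _ X]subr0; apply: eqmodXB => //.
set c := (_ + _); rewrite -[X in eqmodX _ _ X](mulr0 c).
by apply: eqmodXMl; exact: eqmodX_exp0.
Qed.

(** * The factorization, deduced from the functional equations *)

Section Factorization.
Variables (R : idomainType) (N : nat) (x : R).
Variables (E F d A E2 F2 d2 B G : {poly R}).
Local Notation X := (x%:P).
Local Notation "p ~ q" := (eqmodX N p q) (at level 70).
Local Notation D := (F - X * E).
Hypotheses (F0 : F`_0 = 1) (E0 : E`_0 = 1) (x1 : 1 - x != 0).
Hypotheses (dD : D * d ~ 1 - X) (A_d : A ~ E * d - 1).
Hypotheses (EE : E * E ~ E2) (FF : F * F ~ F2).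
Hypotheses (dD2 : (F2 - X * E2) * d2 ~ 1 - X) (Bd2 : B ~ d2 * F).
Hypothesis (GA : (1 - X * A ^+ 2) * G ~ 1 + X * A).

(** [E2], [F2] and [d2] play the series at 2t, and [G] the truncated sum over [k]. Both sides are
    compared after multiplication by a polynomial that can be cancelled. *)
Lemma egf_factorization : B ~ d * G.
Proof.
have DA : D * A ~ E - F.
  apply: eqmodX_trans (eqmodXMl _ A_d) _.
  have -> : D * (E * d - 1) = E * (D * d) - D by ring.
  have -> : E - F = E * (1 - X) - D by ring.
  by apply: eqmodXB => //; exact: eqmodXMl.
(* [M B ~ (1 - x)^2 F ~ M d G] and the constant term of [M] is [(1 - x)^2]. *)
pose M := (1 - X) * (F * F - X * (E * E)).
have defM : M ~ D * D * (1 - X * A ^+ 2).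
  have -> : D * D * (1 - X * A ^+ 2) = D * D - X * ((D * A) * (D * A)) by ring.
  have -> : M = D * D - X * ((E - F) * (E - F)) by rewrite /M; ring.
  apply: eqmodXB => //; apply: eqmodXMl.
  by apply: eqmodXM; exact: eqmodX_sym.
have MB : M * B ~ (1 - X) * ((1 - X) * F).
  rewrite /M -mulrA; apply: eqmodXMl.
  apply: (@eqmodX_trans _ _ ((F2 - X * E2) * (d2 * F))).
    by apply: eqmodXM => //; apply: eqmodXB => //; exact: eqmodXMl.
  by rewrite mulrA; apply: eqmodXM.
apply: (@eqmodX_cancel _ _ M).
  rewrite /M coef0M coefB coefB !coefC /= !coef0M coefC F0 E0 /=.
  by rewrite !mulr1 mulf_neq0.
apply: eqmodX_trans MB _; apply: eqmodX_sym.
apply: (@eqmodX_trans _ _ ((D * d) * (D * ((1 - X * A ^+ 2) * G)))).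
  have -> : D * d * (D * ((1 - X * A ^+ 2) * G))
    = (D * D * (1 - X * A ^+ 2)) * (d * G) by ring.
  exact: eqmodXM.
apply: eqmodXM => //; apply: eqmodX_trans (eqmodXMl _ GA) _.
have -> : D * (1 + X * A) = D + X * (D * A) by ring.
have -> : (1 - X) * F = D + X * (E - F) by ring.
by apply: eqmodXD => //; exact: eqmodXMl.
Qed.

End Factorization.

(** * The functional equations for the actual series *)

Lemma egf_binconv N a b c : (forall i, c i = binconv a b i) ->
  eqmodX N.+1 (egf N a * egf N b) (egf N c).
Proof. by move=> E; rewrite (egf_eq _ E); exact: egfM. Qed.

(** Coefficients of positive degree in t cancel. It serves for weak excedances against
    excedances. *)
Lemma egf_shift N (a b : nat -> {poly int}) : a 0%N = 1 -> b 0%N = 1 ->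
  (forall k, a k.+1 = 'X * b k.+1) ->
  egf N a - 'X%:P * egf N b = 1 - 'X%:P.
Proof.
move=> a0 b0 ab; apply/polyP => i.
rewrite coefB coefCM coefB coef1 coefC !coef_poly.
case: i => [|i]; rewrite ?a0 ?b0 ?ltnS /=.
  by rewrite fact0 invr1 scale1r rmorph1 mulr1.
case: ifP => _; rewrite ?mulr0 ?subr0 // ab rmorphM /= toQX -scalerAr.
by rewrite scalerAr subrr.
Qed.

(** With [eulerianA] and [excPoly], the term -1 reflects the convention that A_0 is 0. *)
Lemma egf_sub1 N (a b : nat -> {poly int}) : a 0%N = 0 -> b 0%N = 1 ->
  (forall k, a k.+1 = b k.+1) -> egf N a = egf N b - 1.
Proof.
move=> a0 b0 ab; apply/polyP => i; rewrite coefB coef1 !coef_poly.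
case: i => [|i]; last by rewrite ab subr0.
rewrite a0 b0 (rmorph0 toQ) (rmorph1 toQ) scaler0.
by rewrite fact0 invr1 scale1r subrr.
Qed.

Lemma binconvC (R : comNzRingType) (a b : nat -> R) n :
  binconv a b n = binconv b a n.
Proof.
rewrite /binconv (reindex_inj rev_ord_inj) /=; apply: eq_bigr => k _.
rewrite subSS subKn; last by rewrite -ltnS.
by rewrite mulrC bin_sub // -ltnS.
Qed.

(** Multiplying coefficient [k] by [2 ^ k] substitutes 2t for t, which respects products. *)
Lemma binconv_dilate (R : comNzRingType) (a b : nat -> R) n :
  binconv (fun k => a k *+ 2 ^ k) (fun k => b k *+ 2 ^ k) n
    = binconv a b n *+ 2 ^ n.
Proof.
rewrite /binconv -sumrMnl; apply: eq_bigr => k _.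
rewrite mulrnAl mulrnAr -!mulrnA; congr (_ *+ _).
have le_kn : (k <= n)%N by rewrite -ltnS.
by rewrite mulnA -expnD subnK // mulnC.
Qed.

(** The coefficient form of e^(xt) e^(xt) = e^(2xt), obtained by counting all subsets of an [n]-set
    by size. *)
Lemma binconv_pow (R : comNzRingType) (x : R) n :
  binconv (fun k => x ^+ k) (fun k => x ^+ k) n = x ^+ n *+ 2 ^ n.
Proof.
have := @sum_by_card _ 'I_n (fun=> x ^+ n).
rewrite sumr_const card_ord.
rewrite -cardsT -powersetT card_powerset cardsT card_ord => ->.
by apply: eq_bigr => k _; rewrite -exprD subnKC // -ltnS.
Qed.

Lemma excPoly0 : excPoly 0 = 1.
Proof.
rewrite /excPoly (eq_bigr (fun=> 1)) => [|u _].
  by rewrite sumr_const card_Sn.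
by rewrite excA_sum big_ord0.
Qed.

Lemma egf_eulerianA N :
  eqmodX N.+1 (egf N eulerianA) (egf N (fun=> 1) * egf N derangA - 1).
Proof.
have eul k : eulerianA k.+1 = excPoly k.+1 by exact: desPoly_excPoly.
rewrite (@egf_sub1 N eulerianA excPoly erefl excPoly0 eul).
apply: eqmodXB => //; apply: eqmodX_sym; apply: egf_binconv => k.
by rewrite excPolyE binconvC.
Qed.

Lemma wexcPoly0 : wexcPoly 0 = 1.
Proof.
rewrite /wexcPoly (eq_bigr (fun=> 1)) => [|u _].
  by rewrite sumr_const card_Sn.
by rewrite eq_card0 // => -[].
Qed.

Lemma egf_derangA N :
  eqmodX N.+1
    ((egf N (fun k => 'X^k) - 'X%:P * egf N (fun=> 1)) * egf N derangA)
    (1 - 'X%:P).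
Proof.
rewrite -(@egf_shift N wexcPoly excPoly wexcPoly0 excPoly0 wexcPolyS).
rewrite mulrBl -mulrA ![_ * egf N derangA]mulrC.
apply: eqmodXB; first by apply: egf_binconv; exact: wexcPolyE.
by apply: eqmodXMl; apply: egf_binconv; exact: excPolyE.
Qed.

Lemma egf_derangA_dilated N :
  eqmodX N.+1
    ((egf N (fun k => 'X^k *+ 2 ^ k) - 'X%:P * egf N (fun k => 1 *+ 2 ^ k))
       * egf N (fun k => derangA k *+ 2 ^ k))
    (1 - 'X%:P).
Proof.
rewrite -(@egf_shift N (fun k => wexcPoly k *+ 2 ^ k)
                     (fun k => excPoly k *+ 2 ^ k)); first last.
- by move=> k; rewrite wexcPolyS mulrnAr.
- exact: excPoly0.
- exact: wexcPoly0.
rewrite mulrBl -mulrA ![_ * egf N (fun k => derangA k *+ _)]mulrC.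
apply: eqmodXB; last apply: eqmodXMl; apply: egf_binconv => k.
  by rewrite wexcPolyE -binconv_dilate.
by rewrite excPolyE -binconv_dilate.
Qed.

(** In the product, the factor of [derangA] carries [r_0] and each of the [k] factors of [eulerianA]
    carries one further part. *)
Lemma egf_sum_products n K :
  toQ (\sum_(k < K.+1)
    \sum_(r : {ffun 'I_k.+1 -> 'I_n.+1} | (\sum_(i < k.+1) (r i : nat))%N == n)
      ((multinom (fun i => (r i : nat)))%:R *: 'X^(k.+1 %/ 2)%N
        * derangA (r ord0)
        * \prod_(i < k) eulerianA (r (lift ord0 i)))) =
  (n`!%:R : rat) *: (egf n derangA *
    \sum_(k < K.+1) ('X ^+ (k.+1 %/ 2))%:P * egf n eulerianA ^+ k)`_n.
Proof.
rewrite mulr_sumr coef_sum scaler_sumr rmorph_sum; apply: eq_bigr => k _.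
pose a (i : 'I_k.+1) := if i == ord0 then derangA else eulerianA.
have -> : egf n derangA * (('X ^+ (k.+1 %/ 2))%:P * egf n eulerianA ^+ k)
  = ('X ^+ (k.+1 %/ 2))%:P * \prod_(i < k.+1) egf n (a i).
  rewrite big_ord_recl (eq_bigr (fun=> egf n eulerianA)) //.
  by rewrite prodr_const card_ord /a eqxx; ring.
rewrite coefCM coef_prod_egf -scalerAr scalerA divff; last first.
  by rewrite pnatr_eq0 -lt0n fact_gt0.
rewrite scale1r -toQX -rmorphXn -rmorphM mulr_sumr; congr (toQ _).
apply: eq_bigr => r _; rewrite big_ord_recl /=.
by rewrite -scalerAr -!scalerAl mulrA.
Qed.

(* The sum over all k : nat is written as the sum over k <= K for an arbitrary
   K >= n (all terms with k > n vanish since A_0 = 0); sequences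
   (r_0,...,r_k) of nonnegative integers summing to n are functions
   r : 'I_(k+1) -> 'I_(n+1) with sum n. *)
Theorem theorem1p1 (n K : nat) : (n <= K)%N ->
  dB n =
  \sum_(k < K.+1)
    \sum_(r : {ffun 'I_k.+1 -> 'I_n.+1} | (\sum_(i < k.+1) (r i : nat))%N == n)
      ((multinom (fun i => (r i : nat)))%:R *: 'X^(k.+1 %/ 2)%N
        * derangA (r ord0)
        * \prod_(i < k) eulerianA (r (lift ord0 i))).
Proof.
move=> le_nK; apply: toQ_inj; rewrite egf_sum_products.
have dB_egf : toQ (dB n) = (n`!%:R : rat) *: (egf n dB)`_n.
  rewrite coef_egf // scalerA divff ?scale1r //.
  by rewrite pnatr_eq0 -lt0n fact_gt0.
rewrite dB_egf; congr (_ *: _).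
have coef0_egf a : (egf n a)`_0 = toQ (a 0%N).
  by rewrite coef_egf // fact0 invr1 scale1r.
set G := \sum_(k < _) _.
(* Only the coefficient of t^n is wanted, and it lies within the precision [n.+1]. *)
suff dB_dG : eqmodX n.+1 (egf n dB) (egf n derangA * G) by exact: dB_dG.
apply: egf_factorization _ _ _ (@egf_derangA n) (@egf_eulerianA n) _ _
  (@egf_derangA_dilated n) _ _.
- by rewrite coef0_egf rmorph1.
- by rewrite coef0_egf rmorph1.
- rewrite subr_eq0; apply/eqP => /(congr1 (fun p : {poly rat} => size p)).
  by rewrite size_polyX size_poly1.
- apply: egf_binconv => k.
  (* The law for [E] is the case x = 1 of the law for [F]. *)
  rewrite -[1](expr1n _ k) -binconv_pow.
  by apply: eq_bigr => j _; rewrite !expr1n.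
- by apply: egf_binconv => k; rewrite binconv_pow.
- apply: eqmodX_sym; apply: egf_binconv; exact: dBE.
(* Since [n <= K] and A_0 = 0, the tail of the sum vanishes modulo t^(n+1). *)
apply: half_geometric_sum => //.
by rewrite coef0_egf rmorph0.
Qed.
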